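(* Let $\Sigma$ be a cylindrical surface in $\mathbb{R}^3$ parametrized by $$X\colon I\times\mathbb{R}\to\mathbb{R}^3,\qquad X(s,t)=\alpha(s)+t\,\vec{w},$$ where $I\subset\mathbb{R}$ is an open interval, $\vec{w}\in\mathbb{R}^3$ is a constant vector with $|\vec{w}|=1$, and $\alpha\colon I\to\mathbb{R}^3$ is a smooth curve parametrized by arc-length and contained in a plane orthogonal to $\vec{w}$. If $\Sigma$ is a stationary surface of the Dirichlet energy, i.e. its anisotropic mean curvature is a constant $\Lambda$, then either $\Lambda=0$, $\alpha$ is (contained in) a straight line and $\Sigma$ is a plane, or $\Lambda\neq0$, $\alpha$ is (contained in) a parabola and $\Sigma$ is a parabolic cylinder.
   Context: The Dirichlet energy of a surface $\Sigma\subset\mathbb{R}^3$ with unit normal $\nu=(\nu_1,\nu_2,\nu_3)$ is $\mathcal{F}(\Sigma)=\int_\Sigma\left(\frac{1}{\nu_3}-\nu_3\right)d\Sigma$; it equals $\int_\Omega|Du|^2$ when $\Sigma$ is the graph $z=u(x,y)$ over $\Omega$. It is only considered for surfaces with $\nu_3\neq0$ everywhere, which is a standing assumption. Such a surface is locally a graph $z=u(x,y)$, and its anisotropic mean curvature for the Dirichlet energy is $\Lambda=2(u_{xx}+u_{yy})$. Equivalently, when $\nu_3^2\neq1$, with $h(v,w)=-\langle d\nu(v),w\rangle$, $e_3=(0,0,1)$, $E_1=e_3-\nu_3\nu$ and $E_2=\nu\times E_1$, it is determined by $\Lambda\nu_3^3(1-\nu_3^2)=2\left(h(E_1,E_1)+\nu_3^2\,h(E_2,E_2)\right)$.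 A surface is a stationary surface of the Dirichlet energy if $\Lambda$ is constant on it, i.e. if locally $u_{xx}+u_{yy}=\Lambda/2$ for a constant $\Lambda\in\mathbb{R}$. A plane or parabolic cylinder here means (an open piece of) one, since $\alpha$ is only defined on the interval $I$. ''Parabolic cylinder'' means a cylinder over a parabola lying in a plane orthogonal to the rulings. *)

(* Defs.v *)
From HB Require Import structures.
From mathcomp Require Import all_boot all_order all_algebra.
From mathcomp Require Import all_classical all_reals all_analysis.
Set Implicit Arguments.
Unset Strict Implicit.
Unset Printing Implicit Defensive.
Import Order.TTheory GRing.Theory Num.Theory.
Import numFieldNormedType.Exports.
Local Open Scope classical_set_scope.
Local Open Scope ring_scope.

(* Euclidean structure of R^3; the library norm on 'rV[R]_3 is the sup norm
   and is used only through its topology. *)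
Section euclidean3.
Variable R : realType.
Implicit Types u v : 'rV[R]_3.

Definition dot u v : R := \sum_i u 0 i * v 0 i.

Definition enorm u : R := Num.sqrt (dot u u).

Definition vec3 (x y z : R) : 'rV[R]_3 :=
  \row_(i < 3) [:: x; y; z]`_i.

Definition cross u v : 'rV[R]_3 :=
  vec3 (u 0 1 * v 0 2 - u 0 2 * v 0 1)
       (u 0 2 * v 0 0 - u 0 0 * v 0 2)
       (u 0 0 * v 0 1 - u 0 1 * v 0 0).

Definition proj12 u : R * R := (u 0 0, u 0 1).

End euclidean3.

(* C^k on an open set A of a finite-dimensional space: f is differentiable on
   A and every directional derivative of f is C^(k-1) on A. *)
Fixpoint Ck_on (R : realType) (V W : normedModType R) (k : nat)
    (A : set V) (f : V -> W) : Prop :=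
  match k with
  | 0 => forall x, A x -> {for x, continuous f}
  | k'.+1 => (forall x, A x -> differentiable f x) /\
             (forall v : V, Ck_on k' A ('D_v f))
  end.

Definition smooth_on (R : realType) (V W : normedModType R)
    (A : set V) (f : V -> W) : Prop :=
  forall k, Ck_on k A f.

Section surfaces.
Variable R : realType.
Implicit Types (X : R * R -> 'rV[R]_3) (u : R * R -> R) (q : R * R).

Definition normal X q : 'rV[R]_3 :=
  cross ('D_((1, 0) : R * R) X q) ('D_((0, 1) : R * R) X q).

Definition unit_normal X q : 'rV[R]_3 :=
  (enorm (normal X q))^-1 *: normal X q.

Definition laplacian u q : R :=
  'D_((1, 0) : R * R) ('D_((1, 0) : R * R) u) q +
  'D_((0, 1) : R * R) ('D_((0, 1) : R * R) u) q.

Definition graph_over u (O : set (R * R)) : set 'rV[R]_3 :=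
  [set p | O (proj12 p) /\ p 0 2 = u (proj12 p)].

(* u represents, as a smooth graph z = u(x, y), a neighbourhood of the point
   with parameter q in the surface X parametrized on D. *)
Definition local_graph (D : set (R * R)) X q u : Prop :=
  exists U O : set (R * R),
    [/\ open U, U q & U `<=` D] /\
    [/\ open O, smooth_on O u & X @` U = graph_over u O].

(* Lambda = 2 (u_xx + u_yy) for a local graph representation u. When X is a
   smooth immersion with nu_3 <> 0 at q, such a u exists by the inverse
   function theorem and its germ at proj12 (X q) is unique, so that Lambda is
   well defined. *)
Definition is_aniso_mean_curvature (D : set (R * R)) X q (Lambda : R) : Prop :=
  exists u, local_graph D X q u /\ Lambda = 2 * laplacian u (proj12 (X q)).

Definition stationary_with (D : set (R * R)) X (Lambda : R) : Prop :=
  forall q, D q -> is_aniso_mean_curvature D X q Lambda.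

End surfaces.

Section shapes.
Variable R : realType.
Implicit Types (w : 'rV[R]_3) (C S P : set 'rV[R]_3).

Definition is_line C : Prop :=
  exists p v : 'rV[R]_3, v != 0 /\ C = [set p + x *: v | x in [set: R]].

Definition is_plane P : Prop :=
  exists p n : 'rV[R]_3, n != 0 /\ P = [set x | dot (x - p) n = 0].

(* Normal form y = a x^2 in the orthonormal frame (e, f) with origin at the
   vertex p of the parabola. *)
Definition is_parabola C : Prop :=
  exists (p e f : 'rV[R]_3) (a : R),
    [/\ enorm e = 1, enorm f = 1, dot e f = 0 & a != 0] /\
    C = [set p + x *: e + (a * x ^+ 2) *: f | x in [set: R]].

Definition in_plane_orthogonal_to w C : Prop :=
  exists c : R, forall x, C x -> dot x w = c.

Definition is_parabolic_cylinder S : Prop :=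
  exists C w, [/\ is_parabola C, enorm w = 1, in_plane_orthogonal_to w C
    & S = [set c + t *: w | c in C & t in [set: R]]].

Definition open_piece S P : Prop :=
  exists O : set 'rV[R]_3, open O /\ S = P `&` O.

Definition cylinder_param (alpha : R -> 'rV[R]_3) w (st : R * R) : 'rV[R]_3 :=
  alpha st.1 + st.2 *: w.

End shapes.

(* Main.v *)
Require Import Defs.
From mathcomp Require Import all_boot all_order all_algebra.
From mathcomp Require Import all_classical all_reals all_analysis.
From mathcomp Require Import ring.
Import Order.TTheory GRing.Theory Num.Theory.
Import numFieldNormedType.Exports.
Local Open Scope classical_set_scope.
Local Open Scope ring_scope.

(* Let g = (-w_2, w_1, 0), x = <alpha, g> and let u be a local graph
   representation. The rulings give D_(w_1, w_2) u = w_3, and comparing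
   velocities gives D_g u = alpha_3' / x' at the point X(s, t). The right-hand
   side does not depend on t, so the mixed second derivative of u along
   (w_1, w_2) and g vanishes and the Laplacian of u reduces to its second
   derivative along g. Differentiating alpha_3' / x' in s then turns the
   stationarity condition into (alpha_3' / x')' = (Lambda / 2) x', which
   integrates to alpha_3 = (Lambda / 4) x^2 + m x + n. *)

(** * Euclidean algebra in coordinates of R^3 *)

Section euclidean3.
Context {R : realType}.
Implicit Types u v z : 'rV[R]_3.

Lemma dotE u v : dot u v = u 0 0 * v 0 0 + u 0 1 * v 0 1 + u 0 2 * v 0 2.
Proof.
rewrite /dot !big_ord_recr big_ord0 /= add0r.
by congr (u 0 _ * v 0 _ + u 0 _ * v 0 _ + u 0 _ * v 0 _); exact: val_inj.
Qed.

Lemma dotDl u v z : dot (u + v) z = dot u z + dot v z.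
Proof. by rewrite !dotE !mxE; ring. Qed.

Lemma dotZl (k : R) u z : dot (k *: u) z = k * dot u z.
Proof. by rewrite !dotE !mxE; ring. Qed.

Lemma dotC u v : dot u v = dot v u.
Proof. by rewrite !dotE; ring. Qed.

Lemma rV3P u v :
  u 0 0 = v 0 0 -> u 0 1 = v 0 1 -> u 0 2 = v 0 2 -> u = v.
Proof.
move=> e0 e1 e2; apply/rowP => -[[|[|[|//]]] lt3].
- by rewrite (_ : Ordinal lt3 = 0) //; exact: val_inj.
- by rewrite (_ : Ordinal lt3 = 1) //; exact: val_inj.
- by rewrite (_ : Ordinal lt3 = 2) //; exact: val_inj.
Qed.

Lemma enorm1 u : (enorm u == 1) = (dot u u == 1).
Proof.
apply/eqP/eqP => [u1|]; last by rewrite /enorm => ->; rewrite sqrtr1.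
have u_ge0 : 0 <= dot u u by rewrite dotE -!expr2 !addr_ge0 ?sqr_ge0.
by rewrite -(sqr_sqrtr u_ge0) -[Num.sqrt _]/(enorm u) u1 expr1n.
Qed.

End euclidean3.

(** * One-variable calculus along curves *)

Section calculus.
Context {R : realType}.
Implicit Types (f g x y : R -> R) (u : R * R -> R) (p a b : R * R).

(** Local relations between the curve and the graph hold only near a parameter; this is the device
    by which they are differentiated. *)
Lemma is_derive_near_unique {f g} {s df dg : R} :
  is_derive s 1 f df -> is_derive s 1 g dg ->
  (\forall t \near s, f t = g t) -> df = dg.
Proof.
by move=> Df Dg fg; have [_ <-] := near_eq_is_derive fg Df; case: Dg.
Qed.

Lemma is_derive_comp_pair {u x y} {s dx dy : R} :
  is_derive s 1 x dx -> is_derive s 1 y dy -> differentiable u (x s, y s) ->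
  is_derive s 1 (fun t => u (x t, y t)) ('D_(dx, dy) u (x s, y s)).
Proof.
move=> [/derivable1_diffP dfx <-] [/derivable1_diffP dfy <-] du.
have dxy : differentiable (fun t => (x t, y t)) s.
  exact: differentiable_pair.
have dux : differentiable (u \o (fun t => (x t, y t))) s.
  exact: differentiable_comp.
split; first exact/derivable1_diffP.
rewrite (deriveE _ dux) diff_comp //= diff_pair //= deriveE //.
by rewrite !deriveE.
Qed.

Lemma derive_lin u p a b (k l : R) : differentiable u p ->
  'D_(k *: a + l *: b) u p = k * 'D_a u p + l * 'D_b u p.
Proof. by move=> du; rewrite !deriveE // linearD !linearZ. Qed.

Lemma is_derive0_cst_in (I : set R) f (r s : R) : is_interval I ->
  (forall t, I t -> is_derive t 1 f 0) -> I r -> I s -> f r = f s.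
Proof.
move=> itvI df.
wlog rs : r s / r <= s => [wl Ir Is|Ir Is].
  by case: (leP r s) => [|/ltW] rs; [|symmetry]; exact: wl.
have Irs t : t \in `[r, s] -> I t.
  by rewrite in_itv /= => ht; exact: itvI Ir Is _ ht.
have [|||c _] := @MVT_segment R f (cst 0) r s.
- exact: rs.
- by move=> t trs; apply/df/Irs/subset_itv_oo_cc.
- apply: derivable_within_continuous => t trs.
  by have [] := df _ (Irs _ trs).
by rewrite mul0r => /subr0_eq ->.
Qed.

(** Here [z] is the slope dy/dx read along the parameter. Two integrations by constancy suffice,
    without inverting [x]: first [z - 2 A x] has zero derivative, then so does
    [y - (A x^2 + m x)]. *)
Lemma quadratic_of_slope (I : set R) x y z (dx : R -> R) (A : R) :
  is_interval I -> I !=set0 ->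
  (forall s, I s -> is_derive s 1 x (dx s)) ->
  (forall s, I s -> is_derive s 1 y (dx s * z s)) ->
  (forall s, I s -> is_derive s 1 z (2 * A * dx s)) ->
  exists m n, forall s, I s -> y s = A * x s ^+ 2 + m * x s + n.
Proof.
move=> itvI [r Ir] Dx Dy Dz.
pose m := z r - 2 * A * x r.
have zE s : I s -> z s = 2 * A * x s + m.
  move=> Is; apply/eqP; rewrite addrC -subr_eq; apply/eqP.
  apply: (@is_derive0_cst_in I (fun t => z t - 2 * A * x t)) => // t It.
  have dxt := Dx _ It; have dzt := Dz _ It.
  apply: is_derive_eq (is_deriveB dzt (is_deriveZ (2 * A) dxt)) _.
  by rewrite /GRing.scale /= subrr.
exists m, (y r - (A * x r ^+ 2 + m * x r)) => s Is.
apply/eqP; rewrite addrC -subr_eq; apply/eqP.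
apply: (@is_derive0_cst_in I
  (fun t => y t - (A * x t ^+ 2 + m * x t))) => // t It.
have dxt := Dx _ It; have dyt := Dy _ It.
rewrite (_ : (fun _ => _) = y - (A *: (x * x) + m *: x)); last first.
  by apply/funext => v; rewrite expr2.
apply: is_derive_eq (is_deriveB dyt
  (is_deriveD (is_deriveZ A (is_deriveM dxt dxt)) (is_deriveZ m dxt))) _.
by rewrite /GRing.scale /= zE //; ring.
Qed.

End calculus.

(** This is e_3 x w, the vector g of the overview. Its scalar product with alpha' is minus the third
    component of alpha' x w, hence the link with the condition on nu_3. *)
Definition horizontal {R : realType} (w : 'rV[R]_3) : 'rV[R]_3 :=
  vec3 (- w 0 1) (w 0 0) 0.

(** * Derivatives and normal of the cylinder parametrization *)

Section cylinder.
Context {R : realType}.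
Implicit Types (w v : 'rV[R]_3) (alpha : R -> 'rV[R]_3) (I : set R).

Lemma dot_horizontal v w :
  dot v (horizontal w) = v 0 1 * w 0 0 - v 0 0 * w 0 1.
Proof. by rewrite dotE /horizontal !mxE /=; ring. Qed.

Lemma is_derive_coord {alpha} {s : R} (i : 'I_3) : derivable alpha s 1 ->
  is_derive s 1 (fun t => alpha t 0 i) (derive1 alpha s 0 i).
Proof.
move=> da; split; first by move/derivable_mxP: da; exact.
by rewrite derive1E derive_mx // mxE.
Qed.

Lemma is_derive_dot {alpha} v {s : R} : derivable alpha s 1 ->
  is_derive s 1 (fun t => dot (alpha t) v) (dot (derive1 alpha s) v).
Proof.
move=> da; have dai i := @is_derive_coord alpha s i da.
rewrite (_ : (fun _ => _) = v 0 0 *: (fun t => alpha t 0 0) +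
  v 0 1 *: (fun t => alpha t 0 1) +
  v 0 2 *: (fun t => alpha t 0 2)); last first.
  by apply/funext => t; rewrite dotE ![_ * v _ _]mulrC.
apply: is_derive_eq (is_deriveD (is_deriveD (is_deriveZ (v 0 0) (dai 0))
  (is_deriveZ (v 0 1) (dai 1))) (is_deriveZ (v 0 2) (dai 2))) _.
by rewrite dotE /GRing.scale /=; ring.
Qed.

Lemma normal_cylinder {alpha} w {s} (t : R) : derivable alpha s 1 ->
  normal (cylinder_param alpha w) (s, t) = cross (derive1 alpha s) w.
Proof.
move=> da.
have D10 : 'D_((1, 0) : R * R) (cylinder_param alpha w) (s, t) =
    derive1 alpha s.
  rewrite derive1E /derive; set F := fun h : R => _; set G := fun h : R => _.
  suff -> : F = G by [].
  apply/funext => h; rewrite {}/F {}/G /=; congr (_ *: _).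
  rewrite /cylinder_param /= /GRing.scale /= !mulr0 add0r.
  by rewrite opprD addrACA subrr addr0.
have D01 : 'D_((0, 1) : R * R) (cylinder_param alpha w) (s, t) = w.
  (* Along a ruling the difference quotient equals [w] for every nonzero increment. *)
  apply/lim_near_cst => //=; near=> h.
  have h0 : h != 0 by near: h; exact: nbhs_dnbhs_neq.
  rewrite /cylinder_param /= [h *: 0]mulr0 [h *: 1]mulr1 add0r.
  rewrite opprD addrACA subrr add0r.
  by rewrite -scalerBl addrK scalerA mulVf ?scale1r.
by rewrite /normal D10 D01.
Unshelve. all: by end_near. Qed.

End cylinder.

(** * Laplacian of a function with constant slope in one direction *)

Section ruled_graph.
Context {R : realType}.
Implicit Types (u : R * R -> R) (p q : R * R) (O U : set (R * R)).

Lemma smooth_on_differentiable {V W : normedModType R} {A : set V}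
    {f : V -> W} {x} :
  smooth_on A f -> A x -> differentiable f x.
Proof. by move=> /(_ 1%N) [df _]; exact: df. Qed.

Lemma smooth_on_derive {V W : normedModType R} {A : set V}
    {f : V -> W} (v : V) :
  smooth_on A f -> smooth_on A ('D_v f).
Proof. by move=> sf k; have [_] := sf k.+1; exact. Qed.

(** The vectors (a, b) and (-b, a) are orthogonal with common squared length a^2 + b^2, so [v] is
    expanded in them by projection. *)
Lemma derive_rotate {u p} {a b : R} (v : R * R) : a ^+ 2 + b ^+ 2 != 0 ->
  differentiable u p ->
  'D_v u p = ((v.1 * a + v.2 * b) * 'D_(a, b) u p +
              (v.2 * a - v.1 * b) * 'D_(- b, a) u p) / (a ^+ 2 + b ^+ 2).
Proof.
move=> ab0 du; set c := a ^+ 2 + b ^+ 2 in ab0 *.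
rewrite [in LHS](_ : v = ((v.1 * a + v.2 * b) / c) *: (a, b) +
              ((v.2 * a - v.1 * b) / c) *: (- b, a)); last first.
  case: v => v1 v2; rewrite /c.
  have pairE (x y : R) : x *: (a, b) + y *: (- b, a) =
    (x * a + y * - b, x * b + y * a) by [].
  by rewrite pairE /=; congr pair; field.
by rewrite derive_lin // [RHS]mulrDl; congr (_ + _); rewrite mulrAC.
Qed.

(** Since the slope along (a, b) is constant, ['D_v u] is near [p] a constant plus m times the
    derivative along (-b, a). Differentiating along [v] again yields the same factor m, because the
    mixed derivative vanishes at [p]. Only this one order of mixed differentiation occurs, so no
    symmetry of second derivatives is invoked. *)
Lemma laplacian_ruled {O u} {a b k : R} {p} : open O -> smooth_on O u ->
  a ^+ 2 + b ^+ 2 != 0 -> O p ->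
  (forall q, O q -> 'D_(a, b) u q = k) ->
  'D_(a, b) ('D_(- b, a) u) p = 0 ->
  'D_(- b, a) ('D_(- b, a) u) p = (a ^+ 2 + b ^+ 2) * laplacian u p.
Proof.
move=> oO su ab0 Op Dk D0; set c := a ^+ 2 + b ^+ 2 in ab0 *.
have sg := smooth_on_derive (- b, a) su.
have dg := smooth_on_differentiable sg Op.
have Dv v : 'D_v ('D_v u) p =
    ((v.2 * a - v.1 * b) / c) ^+ 2 * 'D_(- b, a) ('D_(- b, a) u) p.
  set m := (v.2 * a - v.1 * b) / c.
  pose F := cst ((v.1 * a + v.2 * b) * k / c) + m *: 'D_(- b, a) u.
  have -> : 'D_v ('D_v u) p = 'D_v F p.
    apply: near_eq_derive; near=> q.
    have Oq : O q by near: q; exact: open_nbhs_nbhs.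
    rewrite (derive_rotate _ ab0) ?Dk //; last first.
      exact: smooth_on_differentiable su Oq.
    by rewrite mulrDl [X in _ + X]mulrAC.
  have [_ ->] := is_deriveD (is_derive_cst ((v.1 * a + v.2 * b) * k / c) p v)
     (is_deriveZ m (derivableP (diff_derivable dg))).
  rewrite add0r (derive_rotate _ ab0 dg) D0 mulr0 add0r.
  by rewrite [X in _ *: X]mulrAC -/m expr2 -mulrA.
(* For the two standard basis vectors the factors m are -b/c and a/c, whose squares add up to
   1/c. *)
have sumE (D : R) :
    D = c * (((0 * a - 1 * b) / c) ^+ 2 * D + ((1 * a - 0 * b) / c) ^+ 2 * D).
  by rewrite /c in ab0 *; field.
rewrite [LHS]sumE; congr (_ * _).
by symmetry; exact: (congr2 +%R (Dv (1, 0)) (Dv (0, 1))).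
Unshelve. all: by end_near. Qed.

End ruled_graph.

(** * The differential equation for the slope of the profile *)

Section cylinder_slope.
Context {R : realType}.
Implicit Types (w v : 'rV[R]_3) (alpha : R -> 'rV[R]_3) (I : set R).

Lemma open_slices {U : set (R * R)} {s t : R} : open U -> U (s, t) ->
  (\forall s' \near s, U (s', t)) /\ (\forall t' \near t, U (s, t')).
Proof.
move=> oU Ust.
have nU : nbhs (s, t) U by exact: open_nbhs_nbhs.
split.
  have cs : (z, t) @[z --> s] --> (s, t).
    exact: (@cvg_pair _ _ _ (nbhs s) (nbhs s) (nbhs t) _ _ _ id (cst t)
      cvg_id (cvg_cst _)).
  exact: cs nU.
have ct : (s, z) @[z --> t] --> (s, t).
  exact: (@cvg_pair _ _ _ (nbhs t) (nbhs s) (nbhs t) _ _ _ (cst s) id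
    (cvg_cst _) cvg_id).
exact: ct nU.
Qed.

Lemma is_derive_affine (k l t : R) : is_derive t 1 (fun t' => k + t' * l) l.
Proof.
apply: is_derive_eq (is_deriveD (is_derive_cst k t 1)
  (is_deriveM (is_derive_id t 1) (is_derive_cst l t 1))) _.
by rewrite /GRing.scale /=; ring.
Qed.

Lemma is_derive_slope {alpha w I} {Lambda s0 : R} :
  (forall s, I s -> derivable alpha s 1) -> dot w w = 1 ->
  (forall s, I s -> dot (derive1 alpha s) w = 0) ->
  (forall s, I s -> dot (derive1 alpha s) (horizontal w) != 0) ->
  is_aniso_mean_curvature (I `*` [set: R]) (cylinder_param alpha w) (s0, 0)
    Lambda ->
  is_derive s0 1
    (fun s => derive1 alpha s 0 2 / dot (derive1 alpha s) (horizontal w))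
    (Lambda / 2 * dot (derive1 alpha s0) (horizontal w)).
Proof.
move=> da ww da_w da_hor [u [[U [ O [[oU U0 UD] [oO su XU]]]] ->]].
set X := cylinder_param alpha w in XU *.
pose P s t := proj12 (X (s, t)).
have PE s t : P s t = (alpha s 0 0 + t * w 0 0, alpha s 0 1 + t * w 0 1).
  by rewrite /P /proj12 /X /cylinder_param !mxE.
have UI s t : U (s, t) -> I s by move=> /UD[].
have UO s t : U (s, t) -> O (P s t) /\ X (s, t) 0 2 = u (P s t).
  move=> Ust; apply: (_ : graph_over u O (X (s, t))).
  by rewrite -XU; exists (s, t).
(* The graph lies over all of [O], so identities proved at parameters in [U] hold throughout [O]. *)
have OU p : O p -> exists s t, U (s, t) /\ p = P s t.
  case: p => p1 p2 Op.
  have : graph_over u O (vec3 p1 p2 (u (p1, p2))).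
    by rewrite /graph_over /proj12 /= !mxE.
  rewrite -XU => -[[s t] Ust Xst]; exists s, t; split => //.
  by rewrite /P Xst /proj12 !mxE.
have du p : O p -> differentiable u p by exact: smooth_on_differentiable.
pose a := w 0 0; pose b := w 0 1.
have dX i s t : U (s, t) ->
    is_derive s 1 (fun s => alpha s 0 i + t * w 0 i) (derive1 alpha s 0 i).
  move=> /UI /da /(is_derive_coord i) dai.
  apply: is_derive_eq (is_deriveD dai (is_derive_cst (t * w 0 i) s 1)) _.
  by rewrite addr0.
have dPs (f : R * R -> R) s t : U (s, t) -> differentiable f (P s t) ->
    is_derive s 1 (fun s' => f (P s' t))
      ('D_(derive1 alpha s 0 0, derive1 alpha s 0 1) f (P s t)).
  move=> Ust; under eq_fun do rewrite PE; rewrite PE => df.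
  exact: is_derive_comp_pair (dX 0 _ _ Ust) (dX 1 _ _ Ust) df.
have dPt (f : R * R -> R) s t : differentiable f (P s t) ->
    is_derive t 1 (fun t' => f (P s t')) ('D_(a, b) f (P s t)).
  under eq_fun do rewrite PE; rewrite PE => df.
  exact: is_derive_comp_pair (is_derive_affine _ _ _)
    (is_derive_affine _ _ _) df.
(* Along a ruling both the projection and the height are affine in t, so [u] has slope w_3 there. *)
have Da p : O p -> 'D_(a, b) u p = w 0 2.
  move=> /OU[s [t [Ust ->]]]; have [Ost _] := UO _ _ Ust.
  have := is_derive_near_unique (dPt u s t (du _ Ost))
    (is_derive_affine (alpha s 0 2) (w 0 2) t).
  apply.
  have [_ nU] := open_slices oU Ust.
  near=> t'; have [_ <-] : O (P s t') /\ X (s, t') 0 2 = u (P s t').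
    by apply: UO; near: t'.
  by rewrite /X /cylinder_param !mxE.
have wwE : w 0 0 ^+ 2 + w 0 1 ^+ 2 + w 0 2 ^+ 2 = 1.
  by rewrite -ww dotE !expr2.
pose x' s := dot (derive1 alpha s) (horizontal w).
have x'E s : x' s = derive1 alpha s 0 1 * a - derive1 alpha s 0 0 * b.
  exact: dot_horizontal.
have da_wE s : I s -> derive1 alpha s 0 0 * a + derive1 alpha s 0 1 * b =
    - (derive1 alpha s 0 2 * w 0 2).
  by move=> Is; apply/eqP; rewrite -addr_eq0 -dotE da_w.
have ab0 : a ^+ 2 + b ^+ 2 != 0.
  apply: contra (da_hor _ (UI _ _ U0)); rewrite paddr_eq0 ?sqr_ge0 // !sqrf_eq0.
  by rewrite -/(x' s0) x'E => /andP[/eqP -> /eqP ->]; rewrite !mulr0 subrr.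
(* Used with d = alpha_3', e = w_3 and c = w_1^2 + w_2^2: clearing c gives x D = d (c + e^2), and
   |w| = 1 reduces this to d. *)
have solve (x d D c e : R) : x != 0 -> c != 0 -> c + e ^+ 2 = 1 ->
    (- (d * e) * e + x * D) / c = d -> D = d / x.
  move=> x0 c0 ce E.
  apply: (mulfI x0); rewrite mulrCA divff // mulr1.
  move/(congr1 ( *%R^~ c)): E; rewrite divfK // => E.
  by rewrite -[RHS]mulr1 -ce mulrDr -E; ring.
(* Differentiate alpha_3 + t w_3 = u(P(s, t)) in s and split the projected velocity along (a, b) and
   (-b, a); the first component is -alpha_3' w_3 by orthogonality to [w], the second is x'. *)
have slopeE s t : U (s, t) ->
    'D_(- b, a) u (P s t) = derive1 alpha s 0 2 / x' s.
  move=> Ust; have Is := UI _ _ Ust; have [Ost _] := UO _ _ Ust.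
  have [nUs _] := open_slices oU Ust.
  have := is_derive_near_unique (dPs u s t Ust (du _ Ost)) (dX 2 _ _ Ust).
  rewrite (derive_rotate _ ab0 (du _ Ost)) Da //= da_wE // -x'E => E.
  apply: solve (da_hor _ Is) ab0 wwE (E _); near=> s'.
  have [_ <-] : O (P s' t) /\ X (s', t) 0 2 = u (P s' t) by apply: UO; near: s'.
  by rewrite /X /cylinder_param !mxE.
pose Dg := 'D_(- b, a) u.
have dDg p : O p -> differentiable Dg p.
  exact: smooth_on_differentiable (smooth_on_derive _ su).
have [Op0 _] := UO _ _ U0.
have [nUs nUt] := open_slices oU U0.
have DaDg : 'D_(a, b) Dg (P s0 0) = 0.
  have := is_derive_near_unique (dPt Dg s0 0 (dDg _ Op0))
    (is_derive_cst (derive1 alpha s0 0 2 / x' s0) (0 : R) 1).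
  apply.
  by near=> t; apply: slopeE; near: t.
have DgDg := laplacian_ruled oO su ab0 Op0 Da DaDg.
(* Near s0 the quotient is [Dg] along the projected curve. Only the (-b, a) component x'/c of the
   velocity contributes, and the factor c of [laplacian_ruled] cancels. *)
apply: near_eq_is_derive (is_derive_eq (dPs Dg s0 0 U0 (dDg _ Op0)) _).
  by near=> s; apply: slopeE; near: s.
rewrite (derive_rotate _ ab0 (dDg _ Op0)) /= DgDg DaDg mulr0 add0r -x'E.
have cancel (c x l : R) : c != 0 -> x * (c * l) / c = 2 * l / 2 * x.
  by move=> c0; field.
exact: cancel.
Unshelve. all: by end_near. Qed.

End cylinder_slope.

(* For a unit vector [w], the scaled frame (horizontal w, vertical w) spans the
   plane orthogonal to [w]; both vectors have squared norm w_1^2 + w_2^2. *)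
Definition vertical {R : realType} (w : 'rV[R]_3) : 'rV[R]_3 :=
  cross w (horizontal w).

(** * Orthogonal coordinates attached to a unit vector *)

Section frame.
Context {R : realType} {w : 'rV[R]_3} (ww : dot w w = 1).
Implicit Types z : 'rV[R]_3.
Let c := w 0 0 ^+ 2 + w 0 1 ^+ 2.

Lemma dot_vertical z :
  dot z (vertical w) =
    - w 0 0 * w 0 2 * z 0 0 - w 0 1 * w 0 2 * z 0 1 + c * z 0 2.
Proof.
by rewrite /vertical /cross /horizontal dotE !mxE /= /c; ring.
Qed.

(** The triple product w x (e_3 x w) is e_3 - w_3 w for a unit [w]. Hence on a plane orthogonal to
    [w] the vertical coordinate is the height up to a constant. *)
Lemma dot_verticalE z : dot z (vertical w) = z 0 2 - w 0 2 * dot z w.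
Proof.
rewrite dot_vertical -[z 0 2 in RHS]mul1r -ww !dotE /c; ring.
Qed.

Lemma dot_w_horizontal : dot w (horizontal w) = 0.
Proof. by rewrite dot_horizontal; ring. Qed.

Lemma dot_w_vertical : dot w (vertical w) = 0.
Proof. by rewrite dot_vertical /c; ring. Qed.

Lemma dot_horizontal_vertical : dot (horizontal w) (vertical w) = 0.
Proof. by rewrite dot_vertical /horizontal !mxE /=; ring. Qed.

Lemma dot_horizontal_horizontal : dot (horizontal w) (horizontal w) = c.
Proof. by rewrite dot_horizontal /horizontal !mxE /= /c; ring. Qed.

Lemma dot_vertical_vertical : dot (vertical w) (vertical w) = c.
Proof.
rewrite dot_verticalE [dot _ w]dotC dot_w_vertical mulr0 subr0.
by rewrite /vertical /cross /horizontal !mxE /= /c; ring.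
Qed.

Lemma frame_decomp z : c != 0 ->
  z = (dot z (horizontal w) / c) *: horizontal w +
      (dot z (vertical w) / c) *: vertical w + dot z w *: w.
Proof.
move=> c0.
have wwE : w 0 2 ^+ 2 = 1 - c by rewrite -ww dotE /c; ring.
by apply: rV3P; rewrite dot_verticalE dot_horizontal dotE /vertical /cross
  /horizontal !mxE /=; rewrite /c in c0 wwE *; field: wwE.
Qed.

(** Equal projections force equal horizontal coordinates, hence equal vertical ones; in the latter
    the third coordinate enters with the nonzero coefficient c. *)
Lemma graph_inj (f : R -> R) z z' : c != 0 ->
  dot z (vertical w) = f (dot z (horizontal w)) ->
  dot z' (vertical w) = f (dot z' (horizontal w)) ->
  proj12 z = proj12 z' -> z = z'.
Proof.
move=> c0 zE z'E [e0 e1]; apply: rV3P => //; apply: (mulfI c0).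
move: z'E; rewrite dot_horizontal -e0 -e1 -dot_horizontal -zE !dot_vertical.
by rewrite -e0 -e1 => /addrI.
Qed.

End frame.

(** * Openness of the surface in the model containing it *)

Section pieces.
Context {R : realType}.

(* The domains of the local graph representations provide the open set, which
   avoids any appeal to the inverse function theorem. *)
Lemma open_piece_graph (D : set (R * R)) (X : R * R -> 'rV[R]_3) (Lambda : R)
    (E : set 'rV[R]_3) :
  stationary_with D X Lambda -> X @` D `<=` E ->
  (forall z z', E z -> E z' -> proj12 z = proj12 z' -> z = z') ->
  open_piece (X @` D) E.
Proof.
move=> statX XE Einj.
(* These are the plane domains above which [E] contains only points of the surface; the preimage of
   their union under projection is the open set sought. *)
pose W := [set O : set (R * R) | open O /\
  forall z, E z -> O (proj12 z) -> (X @` D) z].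
exists (@proj12 R @^-1` \bigcup_(O in W) O); split.
  apply: open_comp; last by apply: bigcup_open => O [].
  move=> z _; apply: (@cvg_pair _ _ _ (nbhs z) (nbhs (z 0 0)) (nbhs (z 0 1))
    _ _ _ (fun y => y 0 0) (fun y => y 0 1)); exact: coord_continuous.
rewrite eqEsubset; split => [z|z [Ez [ O [_ WO] Oz]]]; last exact: WO.
move=> /[dup] /XE Ez [q Dq qz]; split => //.
have [u [[U [ O [[oU Uq UD] [oO su XU]]]] _]] := statX q Dq.
exists O; last by have [] : graph_over u O z by rewrite -XU; exists q.
split => // y Ey Oy.
(* The graph point over the projection of [y] lies on the surface, hence in [E], and injectivity of
   the projection identifies it with [y]. *)
pose y' := vec3 (y 0 0) (y 0 1) (u (proj12 y)).
have y'E : proj12 y' = proj12 y by rewrite /proj12 !mxE.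
have [r Ur ry'] : (X @` U) y'.
  by rewrite XU; split; rewrite y'E // !mxE.
have -> : y = y'.
  by apply: Einj => //; rewrite -ry'; apply: XE; exists r => //; exact: UD.
by exists r => //; exact: UD.
Qed.

End pieces.

(** One family covers both conclusions: a plane for A = 0, a parabolic cylinder otherwise. For a
    unit [v] with v_1^2 + v_2^2 nonzero, the scalar products used are v_1^2 + v_2^2 times the frame
    coefficients, which explains the divisions by c below. *)
Definition quadratic_cylinder {R : realType} (v : 'rV[R]_3) (A m n : R) :
    set 'rV[R]_3 :=
  [set z | dot z (vertical v) =
           A * dot z (horizontal v) ^+ 2 + m * dot z (horizontal v) + n].

Definition cross_section {R : realType} (v : 'rV[R]_3) (A m n k : R) :
    set 'rV[R]_3 :=
  quadratic_cylinder v A m n `&` [set z | dot z v = k].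

(** * Recognition of planes, lines, parabolas and parabolic cylinders *)

Section quadratic_cylinders.
Context {R : realType} {w : 'rV[R]_3} (ww : dot w w = 1).
Let c := w 0 0 ^+ 2 + w 0 1 ^+ 2.
Context (c0 : c != 0).
Implicit Types z : 'rV[R]_3.

Lemma dot_frame (x y t : R) :
  let z := x *: horizontal w + y *: vertical w + t *: w in
  [/\ dot z (horizontal w) = x * c, dot z (vertical w) = y * c & dot z w = t].
Proof.
rewrite /= !dotDl !dotZl ww dot_w_horizontal dot_w_vertical //.
rewrite [dot (vertical w) (horizontal w)]dotC dot_horizontal_vertical.
rewrite dot_horizontal_horizontal dot_vertical_vertical // -/c.
rewrite [dot (horizontal w) w]dotC [dot (vertical w) w]dotC.
rewrite dot_w_horizontal dot_w_vertical //; split; ring.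
Qed.

Lemma quadratic_cylinder_inj (A m n : R) z z' :
  quadratic_cylinder w A m n z -> quadratic_cylinder w A m n z' ->
  proj12 z = proj12 z' -> z = z'.
Proof.
exact: graph_inj (fun x => A * x ^+ 2 + m * x + n) z z' c0.
Qed.

Lemma is_plane_cylinder (m n : R) : is_plane (quadratic_cylinder w 0 m n).
Proof.
(* Normal of the plane Y = m X + n in the frame; the trivial coefficients 1 and 0 are kept to match
   [dot_frame]. *)
pose N := - m *: horizontal w + 1 *: vertical w + 0 *: w.
have [_ Nv _] := dot_frame (- m) 1 0; rewrite -/N mul1r in Nv.
have dotN z : dot z N = dot z (vertical w) - m * dot z (horizontal w).
  by rewrite [LHS]dotC !dotDl !dotZl ![dot _ z]dotC; ring.
have dotp : dot ((n / c) *: vertical w) N = n.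
  by rewrite dotZl dotC Nv divfK.
exists ((n / c) *: vertical w), N; split.
  apply: contra c0 => /eqP N0; rewrite -Nv N0 -(scale0r w) dotZl mul0r.
  exact: eqxx.
apply/seteqP; split => z /=; rewrite -scaleN1r dotDl dotZl dotp dotN
  /quadratic_cylinder /= => E.
  by rewrite E; ring.
by apply/eqP; rewrite -subr_eq0; apply/eqP; rewrite -[RHS]E; ring.
Qed.

Lemma is_line_cross_section (m n k : R) : is_line (cross_section w 0 m n k).
Proof.
(* The point with coordinates (0, n, k); the direction [v] is scaled so that x is the horizontal
   coordinate of p + x v. *)
pose p := 0 *: horizontal w + (n / c) *: vertical w + k *: w.
pose v := c^-1 *: horizontal w + (m / c) *: vertical w + 0 *: w.
have pvE x : p + x *: v =
    (x / c) *: horizontal w + ((m * x + n) / c) *: vertical w + k *: w.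
  rewrite /p /v; move: (horizontal w) (vertical w) => h u.
  by apply/rowP => i; rewrite !mxE; ring.
exists p, v; split.
  have [vh _ _] := dot_frame c^-1 (m / c) 0; rewrite -/v mulVf // in vh.
  apply: contra (oner_neq0 R) => /eqP v0.
  rewrite -vh v0 -(scale0r w) dotZl mul0r.
  exact: eqxx.
apply/seteqP; split => [z [zE zk]|z /= [x _ <-]].
  exists (dot z (horizontal w)) => //.
  rewrite pvE [RHS](frame_decomp ww z) // zk zE -/c.
  by congr (_ + (_ / _) *: _ + _); ring.
rewrite pvE; have [xh xv xw] := dot_frame (x / c) ((m * x + n) / c) k.
by split => //=; rewrite /quadratic_cylinder /= xh xv !divfK //; ring.
Qed.

Lemma is_parabola_cross_section (A m n k : R) : A != 0 ->
  is_parabola (cross_section w A m n k).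
Proof.
move=> A0; pose r := Num.sqrt c.
have rr : r ^+ 2 = c by rewrite sqr_sqrtr // addr_ge0 ?sqr_ge0.
have r0 : r != 0 by rewrite -sqrf_eq0 rr.
(* Completing the square puts the vertex at horizontal coordinate -m/(2A) and vertical coordinate n
   - m^2/(4A). *)
pose p := - (m / (2 * A * c)) *: horizontal w +
  ((n - m ^+ 2 / (4 * A)) / c) *: vertical w + k *: w.
(* Normalising both frame vectors by r = sqrt c multiplies lengths by r in each coordinate, so A (r
   x)^2 / r gives the leading coefficient A r. *)
have pE x : p + x *: (r^-1 *: horizontal w) +
    (A * r * x ^+ 2) *: (r^-1 *: vertical w) =
    ((r * x - m / (2 * A)) / c) *: horizontal w +
    ((n - m ^+ 2 / (4 * A) + A * (r * x) ^+ 2) / c) *: vertical w + k *: w.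
  rewrite /p; move: (horizontal w) (vertical w) => h u.
  by apply/rowP => i; rewrite !mxE -rr; field; rewrite r0.
exists p, (r^-1 *: horizontal w), (r^-1 *: vertical w), (A * r); split.
  split; last by rewrite mulf_neq0.
  - apply/eqP; rewrite enorm1 dotZl dotC dotZl dot_horizontal_horizontal.
    rewrite -/c -rr.
    by apply/eqP; field.
  - apply/eqP; rewrite enorm1 dotZl dotC dotZl dot_vertical_vertical //.
    rewrite -/c -rr.
    by apply/eqP; field.
  - by rewrite dotZl dotC dotZl dotC dot_horizontal_vertical !mulr0.
apply/seteqP; split => [z [zE zk]|z /= [x _ <-]].
  exists ((dot z (horizontal w) + m / (2 * A)) / r) => //.
  rewrite pE mulrCA divff // mulr1 [RHS](frame_decomp ww z) // zk zE -/c addrK.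
  by congr (_ + (_ / _) *: _ + _); field.
rewrite pE.
have [xh xv xw] := dot_frame ((r * x - m / (2 * A)) / c)
  ((n - m ^+ 2 / (4 * A) + A * (r * x) ^+ 2) / c) k.
by split => //=; rewrite /quadratic_cylinder /= xh xv !divfK //; field.
Qed.

Lemma is_parabolic_cylinder_quadratic (A m n : R) : A != 0 ->
  is_parabolic_cylinder (quadratic_cylinder w A m n).
Proof.
move=> A0; exists (cross_section w A m n 0), w; split.
- exact: is_parabola_cross_section.
- by apply/eqP; rewrite enorm1 ww.
- by exists 0 => z [].
have shift z t : quadratic_cylinder w A m n z ->
    quadratic_cylinder w A m n (z + t *: w).
  rewrite /quadratic_cylinder /= !dotDl !dotZl.
  by rewrite dot_w_horizontal dot_w_vertical // !mulr0 !addr0.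
apply/seteqP; split => [z zE|_ [z [zE _] [t _ <-]]]; last exact: shift.
(* Slide [z] along its ruling to the plane through the origin orthogonal to [w], which carries the
   chosen profile. *)
exists (z + (- dot z w) *: w).
  by split; [exact: shift|rewrite /= dotDl dotZl ww; ring].
by exists (dot z w) => //; rewrite -addrA -scalerDl addNr scale0r addr0.
Qed.

End quadratic_cylinders.

(** * Integration of the slope equation and the dichotomy on Lambda *)

Theorem theorem3p1 (R : realType) (I : set R) (alpha : R -> 'rV[R]_3)
    (w : 'rV[R]_3) (Lambda : R)
    (I_open : open I) (I_interval : is_interval I) (I_nonempty : I !=set0)
    (w_unit : enorm w = 1)
    (alpha_smooth : smooth_on I alpha)
    (alpha_arclength : forall s, I s -> enorm (derive1 alpha s) = 1)
    (alpha_planar : in_plane_orthogonal_to w (alpha @` I))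
    (nu3_neq0 : forall q, (I `*` [set: R]) q ->
       unit_normal (cylinder_param alpha w) q 0 2 != 0)
    (stationary :
       stationary_with (I `*` [set: R]) (cylinder_param alpha w) Lambda) :
  let Sigma := cylinder_param alpha w @` (I `*` [set: R]) in
  [/\ Lambda = 0,
      (exists L, is_line L /\ alpha @` I `<=` L) &
      (exists P, is_plane P /\ open_piece Sigma P)] \/
  [/\ Lambda != 0,
      (exists C, is_parabola C /\ alpha @` I `<=` C) &
      (exists S, is_parabolic_cylinder S /\ open_piece Sigma S)].
Proof.
move=> Sigma.
have ww : dot w w = 1 by apply/eqP; rewrite -enorm1 w_unit.
have [k alpha_w] := alpha_planar.
have alphak s : I s -> dot (alpha s) w = k.
  by move=> Is; apply: alpha_w; exists s.
have da s : I s -> derivable alpha s 1.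
  move=> Is; apply/derivable1_diffP.
  exact: smooth_on_differentiable alpha_smooth Is.
have da_w s : I s -> dot (derive1 alpha s) w = 0.
  move=> Is; have := is_derive_near_unique (is_derive_dot w (da _ Is))
    (is_derive_cst k s 1).
  apply; near=> s'; apply: alphak; near: s'; exact: open_nbhs_nbhs.
(* If this product vanished, so would the third component of alpha' x w, against nu_3 being
   nonzero. *)
have da_hor s : I s -> dot (derive1 alpha s) (horizontal w) != 0.
  move=> Is; apply: contra (nu3_neq0 (s, 0) (conj Is Logic.I)) => /eqP hor0.
  rewrite /unit_normal normal_cylinder ?mxE ?mulf_eq0; last exact: da.
  by apply/orP; right; rewrite /= -oppr_eq0 opprB -hor0 dot_horizontal.
have c0 : w 0 0 ^+ 2 + w 0 1 ^+ 2 != 0.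
  case: I_nonempty => s /da_hor; apply: contra.
  rewrite paddr_eq0 ?sqr_ge0 // !sqrf_eq0 dot_horizontal.
  by move=> /andP[/eqP -> /eqP ->]; rewrite !mulr0 subrr.
(* Chosen so that 2 A = Lambda / 2, the rate in the slope equation. *)
pose A := Lambda / 4.
pose x s := dot (alpha s) (horizontal w).
pose dx s := dot (derive1 alpha s) (horizontal w).
have [m [n yE]] : exists m n, forall s, I s ->
    alpha s 0 2 = A * x s ^+ 2 + m * x s + n.
  apply: (@quadratic_of_slope _ I x _
    (fun s => derive1 alpha s 0 2 / dx s) dx) => // s Is.
  - exact: is_derive_dot (da _ Is).
  - apply: is_derive_eq (is_derive_coord 2 (da _ Is)) _.
    by rewrite mulrCA divff ?mulr1 // da_hor.
  - have statE := stationary (s, 0) (conj Is Logic.I).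
    apply: is_derive_eq (is_derive_slope da ww da_w da_hor statE) _.
    by rewrite /A /dx; field.
(* Passing from the height alpha_3 to the vertical coordinate subtracts w_3 k, by
   [dot_verticalE]. *)
pose n' := n - w 0 2 * k.
have SigmaE : Sigma `<=` quadratic_cylinder w A m n'.
  move=> _ [[s t] [/= Is _] <-]; rewrite /cylinder_param /quadratic_cylinder /=.
  rewrite !dotDl !dotZl dot_w_horizontal dot_w_vertical // !mulr0 !addr0.
  by rewrite dot_verticalE // yE // alphak // /x /n'; ring.
have alphaE : alpha @` I `<=` cross_section w A m n' k.
  move=> _ [s Is <-]; split; last exact: alphak.
  apply: SigmaE; exists (s, 0) => //.
  by rewrite /cylinder_param /= scale0r addr0.
have pieceE : open_piece Sigma (quadratic_cylinder w A m n').
  apply: open_piece_graph stationary SigmaE _.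
  exact: quadratic_cylinder_inj.
have A0 : (A == 0) = (Lambda == 0).
  by rewrite /A mulf_eq0 invr_eq0 pnatr_eq0 orbF.
have [L0|L0] := eqVneq Lambda 0; [left|right]; split => //.
- exists (cross_section w A m n' k); split => //.
  by have /eqP -> : A == 0 by [rewrite A0 L0]; exact: is_line_cross_section.
- exists (quadratic_cylinder w A m n'); split => //.
  by have /eqP -> : A == 0 by [rewrite A0 L0]; exact: is_plane_cylinder.
- exists (cross_section w A m n' k); split => //.
  by apply: is_parabola_cross_section; rewrite ?A0.
- exists (quadratic_cylinder w A m n'); split => //.
  by apply: is_parabolic_cylinder_quadratic; rewrite ?A0.
Unshelve. all: by end_near. Qed.
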